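(* Let $p \geq 1$ and $n \geq 2$ be any integers. (i) The identities $x^{n+p} \approx x^n$ and $xy \approx yx$ constitute an identity basis for the variety $\operatorname{var}\{\mathbb{Z}_p,N_n^1\}$ of semigroups. (ii) The variety $\operatorname{var}\{\mathbb{Z}_p,N_n^1\}$ contains countably infinitely many subvarieties (that is, its set of subvarieties is countably infinite).
   Context: All varieties are varieties of semigroups, and all identities are semigroup identities; associativity is always assumed. For semigroups $S,T$, $\operatorname{var}\{S,T\}$ denotes the variety generated by $S$ and $T$, i.e. the smallest class of semigroups containing $S$ and $T$ and closed under homomorphic images, subsemigroups, and arbitrary direct products. An identity basis for a variety $\mathbf{V}$ is a set of identities satisfied by $\mathbf{V}$ from which every identity satisfied by $\mathbf{V}$ can be deduced. $N_n=\langle a \mid a^n=0\rangle=\{a,a^2,\ldots,a^{n-1},0\}$ is the monogenic nilpotent semigroup of order $n$, and $N_n^1$ is the monoid obtained from $N_n$ by adjoining an identity element. $\mathbb{Z}_p$ is the cyclic group of order $p$ regarded as a semigroup. *)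

(* Defs.v *)
From HB Require Import structures.
From mathcomp Require Import all_boot all_order all_algebra all_fingroup.
From mathcomp Require Import all_classical.
From mathcomp Require Import zify.

Set Implicit Arguments.
Unset Strict Implicit.
Unset Printing Implicit Defensive.

Local Open Scope group_scope.
Local Open Scope classical_set_scope.

(* A word is its first letter paired with the (possibly empty) list of the
   remaining ones, so that words are exactly the elements of the free semigroup
   over the countably infinite alphabet nat. *)
Definition word : Type := (nat * seq nat)%type.

HB.instance Definition _ := Choice.on word.

Definition word_mul (u v : word) : word := (u.1, u.2 ++ v.1 :: v.2).

Lemma word_mulA : associative word_mul.
Proof. by case=> x s [y t] [z r]; rewrite /word_mul /= -catA. Qed.

HB.instance Definition _ := isSemigroup.Build word word_mulA.

Definition letter (x : nat) : word := (x, [::]).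

(* The word x^k, meaningful for k >= 1 only: there is no empty word. *)
Definition letter_pow (x k : nat) : word := (x, nseq k.-1 x).

(* The image of w under the homomorphism from the free semigroup to S that
   extends t; for S = word this is substitution. *)
Definition eval_word (S : semigroupType) (t : nat -> S) (w : word) : S :=
  foldl (fun s x => s * t x) (t w.1) w.2.

Definition identity : Type := (word * word)%type.

Definition satisfies (S : semigroupType) (e : identity) : Prop :=
  forall t : nat -> S, eval_word t e.1 = eval_word t e.2.

(* The rules of equational logic; associativity is built into words. *)
Inductive deducible (B : set identity) : word -> word -> Prop :=
| ded_axiom u v of B (u, v) : deducible B u v
| ded_refl u : deducible B u u
| ded_sym u v of deducible B u v : deducible B v u
| ded_trans u v w of deducible B u v & deducible B v w : deducible B u w
| ded_mul u u' v v' of deducible B u u' & deducible B v v' :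
    deducible B (u * v) (u' * v')
| ded_subst (t : nat -> word) u v of deducible B u v :
    deducible B (eval_word t u) (eval_word t v).

(* Classes of semigroups are plain predicates: the universe of [set] in
   mathcomp.classical is too small for [set semigroupType] to be well-formed. *)
Definition sgclass := semigroupType -> Prop.

Definition class_satisfies (V : sgclass) (e : identity) : Prop :=
  forall S, V S -> satisfies S e.

Definition identity_basis (V : sgclass) (B : set identity) : Prop :=
  (forall e, B e -> class_satisfies V e) /\
  (forall u v, class_satisfies V (u, v) -> deducible B u v).

Definition sg_product (I : Type) (T : I -> semigroupType) : Type :=
  forall i, T i.

Section SgProduct.
Variables (I : Type) (T : I -> semigroupType).

HB.instance Definition _ := Choice.copy (sg_product T) (forall i, T i).

Definition sg_product_mul (f g : sg_product T) : sg_product T :=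
  fun i => f i * g i.

Lemma sg_product_mulA : associative sg_product_mul.
Proof.
by move=> f g h; apply: functional_extensionality_dep => i; apply: mulgA.
Qed.

HB.instance Definition _ :=
  isSemigroup.Build (sg_product T) sg_product_mulA.

End SgProduct.

(* A semigroupType may be empty, whereas semigroups are nonempty by convention;
   hence the first clause and the hypothesis inhabited S in the third.
   Subsemigroups are taken up to isomorphism, as domains of embeddings; since a
   variety is closed under homomorphic images, this changes nothing. *)
Definition variety (V : sgclass) : Prop :=
  [/\ forall S, V S -> inhabited S,
      forall (S T : semigroupType) (f : {multiplicative S -> T}),
        (forall y, exists x, f x = y) -> V S -> V T,
      forall (S T : semigroupType) (f : {multiplicative S -> T}),
        inhabited S -> injective f -> V T -> V S
    & forall (I : Type) (T : I -> semigroupType),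
        (forall i, V (T i)) -> V (sg_product T)].

Definition var2 (A B : semigroupType) : sgclass :=
  fun S => forall V : sgclass, variety V -> V A -> V B -> V S.

(* Under the extensionality axioms of boolp, = on sgclass means having the same
   members, which is what counting subvarieties requires. *)
Definition subvariety (V W : sgclass) : Prop :=
  variety W /\ (forall S, W S -> V S).

(* f is a bijection from nat onto the elements satisfying P. *)
Definition countably_infinite (X : Type) (P : X -> Prop) : Prop :=
  exists f : nat -> X, injective f /\ (forall x, P x <-> exists k, f k = x).

(* The additive group of integers modulo p, whose group law in MathComp is
   addition modulo p when p >= 1; the type is convertible to 'I_p when p is a successor. *)
Definition cyclic_semigroup (p : nat) : semigroupType := 'I_p.-1.+1.

(* The ordinal i stands for a^(i+1); in particular n.-1 stands for a^n = 0. *)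
Definition nil_sg (n : nat) : Type := 'I_n.

Section NilSg.
Variable n : nat.

HB.instance Definition _ := Choice.copy (nil_sg n) 'I_n.

Lemma nil_sg_mul_subproof (i j : 'I_n) : minn (i + j).+1 n.-1 < n.
Proof. by rewrite gtn_min (ltn_predK (ltn_ord i)) leqnn orbT. Qed.

Definition nil_sg_mul (i j : nil_sg n) : nil_sg n := Ordinal (nil_sg_mul_subproof i j).

Lemma nil_sg_mulA : associative nil_sg_mul.
Proof.
by move=> i j k; apply: val_inj => /=; rewrite -!addSn; lia.
Qed.

HB.instance Definition _ := isSemigroup.Build (nil_sg n) nil_sg_mulA.

End NilSg.

(* S with a new identity element None. *)
Definition adjoin1 (S : Type) : Type := option S.

Section Adjoin1.
Variable S : semigroupType.

HB.instance Definition _ := Choice.copy (adjoin1 S) (option S).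

Definition adjoin1_mul (x y : adjoin1 S) : adjoin1 S :=
  match x, y with
  | None, _ => y
  | _, None => x
  | Some a, Some b => Some (a * b)
  end.

Lemma adjoin1_mulA : associative adjoin1_mul.
Proof. by case=> [a|] [b|] [c|] //=; rewrite mulgA. Qed.

Lemma adjoin1_mul1g : left_id None adjoin1_mul.
Proof. by case. Qed.

Lemma adjoin1_mulg1 : right_id None adjoin1_mul.
Proof. by case. Qed.

HB.instance Definition _ :=
  isMonoid.Build (adjoin1 S) adjoin1_mulA adjoin1_mul1g adjoin1_mulg1.

End Adjoin1.

Definition nil_monoid (n : nat) : semigroupType := adjoin1 (nil_sg n).

(* Main.v *)
(* (i) By evaluating at single letters, an identity u = v holds in Z_p and in
   N_n^1 exactly when every letter occurs equally often in u and v up to the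
   reduction of exponents modulo x^(n+p) = x^n.  Any commutative semigroup with
   x^(n+p) = x^n satisfies such an identity, in particular the quotient of the
   free semigroup by deducibility, so u = v is deducible.

   (ii) By Birkhoff's theorem a subvariety is determined by its identities.  Up
   to renaming letters and reducing exponents, an identity is a table counting
   the letters with each of the finitely many pairs of reduced exponents; a
   table that is pointwise larger with the same support is a consequence,
   obtained by substituting products of letters for letters.  Hence Dickson's
   lemma makes every subvariety finitely based, so there are countably many.
   The identities x_0 ... x_j = y^2 define infinitely many of them, separated
   by the semigroups of subsets of a k-element set under disjoint union. *)

Require Import Defs.
From HB Require Import structures.
From mathcomp Require Import all_boot all_order all_algebra all_fingroup.
From mathcomp Require Import all_classical.
From mathcomp Require Import generic_quotient zify.

Set Implicit Arguments.
Unset Strict Implicit.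
Unset Printing Implicit Defensive.

Local Open Scope group_scope.
Local Open Scope classical_set_scope.
Local Open Scope card_scope.

(** * Evaluation of words and Birkhoff's theorem *)

Definition bundle_mul (S T : semigroupType) (f : S -> T)
    (fM : {morph f : x y / x * y}) : {multiplicative S -> T} :=
  HB.pack f (isMultiplicative.Build S T f fM).

(** [eval_word] over an arbitrary alphabet: Birkhoff's theorem takes the carrier of a semigroup as
    its alphabet. *)
Definition eval_over (X : Type) (S : semigroupType) (t : X -> S)
    (w : X * seq X) : S :=
  foldl (fun s x => s * t x) (t w.1) w.2.

Section Evaluation.
Variable X : Type.

Lemma eval_over_mul (S : semigroupType) (t : X -> S) (u v : X * seq X) :
  eval_over t (u.1, u.2 ++ v.1 :: v.2) = eval_over t u * eval_over t v.
Proof.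
rewrite /eval_over /= foldl_cat /=; move: (foldl _ _ u.2) => a.
by elim/last_ind: v.2 => [|s x IHs] //; rewrite !foldl_rcons IHs mulgA.
Qed.

Lemma eval_over_morph (S T : semigroupType) (f : {multiplicative S -> T})
    (t : X -> S) (w : X * seq X) :
  f (eval_over t w) = eval_over (f \o t) w.
Proof.
rewrite /eval_over; elim/last_ind: w.2 => [|s x IHs] //.
by rewrite !foldl_rcons gmulfM IHs.
Qed.

Lemma eval_over_map (Y : Type) (S : semigroupType) (t : Y -> S) (g : X -> Y)
    (w : X * seq X) :
  eval_over t (g w.1, map g w.2) = eval_over (t \o g) w.
Proof.
rewrite /eval_over /=; elim/last_ind: w.2 => [|s x IHs] //.
by rewrite map_rcons !foldl_rcons IHs.
Qed.

Lemma eval_over_product (I : Type) (T : I -> semigroupType)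
    (t : X -> sg_product T) (w : X * seq X) (i : I) :
  eval_over t w i = eval_over (fun x => t x i) w.
Proof.
rewrite /eval_over; elim/last_ind: w.2 => [|s x IHs] //.
by rewrite !foldl_rcons -IHs.
Qed.

End Evaluation.

Lemma eval_word_mul (S : semigroupType) (t : nat -> S) (u v : word) :
  eval_word t (u * v) = eval_word t u * eval_word t v.
Proof. exact: eval_over_mul. Qed.

Lemma eval_word_subst (S : semigroupType) (t : nat -> S) (s : nat -> word)
    (w : word) :
  eval_word t (eval_word s w) = eval_word (fun x => eval_word t (s x)) w.
Proof.
case: w => x r; rewrite /eval_word /=.
elim/last_ind: r => [|r y IHr] //=.
by rewrite !foldl_rcons -IHr -!/(eval_word _ _) eval_word_mul.
Qed.

Lemma eval_word_letter (w : word) : eval_word letter w = w.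
Proof.
case: w => x r; rewrite /eval_word /=.
elim/last_ind: r => [|r y IHr] //=.
by rewrite foldl_rcons IHr /mul /= /word_mul /= cats1.
Qed.

Definition models (B : set identity) : sgclass :=
  fun S => inhabited S /\ forall e, B e -> satisfies S e.

Lemma models_variety (B : set identity) : variety (models B).
Proof.
split.
- by move=> S [].
- move=> S T f fsurj [[s0] SB]; split=> [|e /SB Se t]; first exact: inhabits (f s0).
  (* A valuation in the image lifts along a section [g] of [f]. *)
  have [g fg] := choice fsurj.
  have -> : t = f \o (g \o t) by apply/funext => x /=; rewrite fg.
  by rewrite -![eval_word _ _]eval_over_morph; congr (f _); apply: Se.
- move=> S T f Sinh finj [_ TB]; split=> // e /TB Te t; apply: finj.
  by rewrite ![f _]eval_over_morph; apply: Te.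
- move=> I T TB; split.
    have tinh i : exists x : T i, True by have [[x] _] := TB i; exists x.
    by split=> i; have [x _] := cid (tinh i); exact: x.
  move=> e eB t; apply: functional_extensionality_dep => i.
  by rewrite [LHS]eval_over_product [RHS]eval_over_product; apply: (TB i).2.
Qed.

Section Image.
Variables (W : Type) (T : semigroupType) (m : W -> W -> W) (h : W -> T).
Hypothesis hM : forall u v, h (m u v) = h u * h v.

(** The subsemigroup of values of [h]; associativity is inherited from [T], so [W] carries only a
    binary operation. *)
Definition image_sg : Type := {y : T | `[< exists w, h w = y >]}.

HB.instance Definition _ := Choice.on image_sg.

Lemma image_sg_mul_subproof (a b : image_sg) :
  `[< exists w, h w = val a * val b >].
Proof.
have [u <-] := asboolW (valP a); have [v <-] := asboolW (valP b).
by apply/asboolP; exists (m u v).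
Qed.

Definition image_sg_mul (a b : image_sg) : image_sg :=
  exist _ (val a * val b) (image_sg_mul_subproof a b).

Lemma image_sg_mulA : associative image_sg_mul.
Proof. by move=> a b c; apply: val_inj; rewrite /= mulgA. Qed.

Definition image_semigroup : semigroupType :=
  HB.pack image_sg (isSemigroup.Build image_sg image_sg_mulA).

Lemma image_elt_subproof (w : W) : `[< exists w', h w' = h w >].
Proof. by apply/asboolP; exists w. Qed.

Definition image_elt (w : W) : image_semigroup :=
  exist _ (h w) (image_elt_subproof w).

End Image.

(* The words over the carrier of S are mapped into a product of members of V
   with one factor for each pair of words that some member of V separates; S is
   an image of the subsemigroup of values. *)
Theorem birkhoff (V : sgclass) (S : semigroupType) :
  variety V -> inhabited S ->
  (forall e, class_satisfies V e -> satisfies S e) -> V S.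
Proof.
move=> [_ Vim Vsub Vprod] [s0] Sid.
pose F : Type := (S * seq S)%type.
pose sep (u v : F) (T : semigroupType) (t : S -> T) :=
  V T /\ eval_over t u <> eval_over t v.
pose I : Type := {i : F * F | exists T t, @sep i.1 i.2 T t}.
have [T HT] := choice (fun i : I => projT2 i).
have [t Ht] := all_tag (fun i => cid (HT i)).
have VP : V (sg_product T) by apply: Vprod => i; case: (Ht i).
pose m (u v : F) : F := (u.1, u.2 ++ v.1 :: v.2).
pose c (s : S) : sg_product T := fun i => t i s.
pose h (w : F) := eval_over c w.
have h_mul u v : h (m u v) = h u * h v by exact: eval_over_mul.
have h_eval u v : h u = h v -> eval_over id u = eval_over id v.
  (* Identities have their letters in [nat], so the finitely many elements of [S] occurring in [u]
     or [v] are renamed to their positions in [L]. *)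
  move=> huv; pose L := u.1 :: u.2 ++ v.1 :: v.2.
  pose r (w : F) : word := (index w.1 L, map (index^~ L) w.2).
  have rE (w : F) : {subset w.1 :: w.2 <= L} ->
      eval_word (nth s0 L) (r w) = eval_over id w.
    move=> wL; rewrite [LHS]eval_over_map; case: w wL => x s wL.
    rewrite /eval_over /= nth_index ?wL ?mem_head //.
    have {wL}: {subset s <= L} by move=> y ys; rewrite wL ?inE ?ys ?orbT.
    elim/last_ind: s => [|s y IHs] sL //.
    rewrite !foldl_rcons IHs /= ?nth_index ?sL ?mem_rcons ?mem_head //.
    by move=> z zs; rewrite sL ?mem_rcons ?inE ?zs ?orbT.
  rewrite -!rE; first 1 last.
  - by move=> x; rewrite /L !inE mem_cat inE => /orP[] ->; rewrite ?orbT.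
  - by move=> x; rewrite /L !inE mem_cat inE => /orP[] ->; rewrite ?orbT.
  apply: (Sid (r u, r v)) => T' VT' t' /=.
  (* A member of [V] refuting the renamed identity would separate [u] from [v]; the factor of the
     product at this pair would then contradict [huv]. *)
  rewrite ![eval_word _ _]eval_over_map; apply: contrapT => neq.
  have ex : exists T t, @sep u v T t by exists T', (t' \o index^~ L).
  have [_ /=] := Ht (exist _ (u, v) ex).
  by apply; rewrite -!(eval_over_product c) -!/(h _) huv.
pose Q := image_semigroup h_mul.
have VQ : V Q.
  have vM : {morph (fun a : Q => val a) : x y / x * y} by [].
  have Qinh : inhabited Q := inhabits (image_elt h_mul (s0, [::])).
  by apply: (Vsub Q _ (bundle_mul vM) Qinh _ VP) => a b; apply: val_inj.
have [g Hg] := choice (fun a : Q => asboolW (valP a)).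
(* By [h_eval] the value does not depend on the word picked by [g], which makes [f]
   multiplicative. *)
pose f (a : Q) : S := eval_over id (g a).
have fM : {morph f : x y / x * y}.
  by move=> a b; rewrite -eval_over_mul; apply: h_eval; rewrite h_mul !Hg.
apply: (Vim Q S (bundle_mul fM) _ VQ) => x.
by exists (image_elt h_mul (x, [::])); apply: (h_eval _ (x, [::])); rewrite Hg.
Qed.

(** * Soundness and completeness of deduction *)

Lemma deducible_sound (B : set identity) (S : semigroupType) (u v : word) :
  (forall e, B e -> satisfies S e) -> deducible B u v -> satisfies S (u, v).
Proof.
move=> SB; elim=> {u v} //=.
- by move=> u v /SB.
- by move=> u v _ IH t /=; rewrite [RHS]IH.
- by move=> u v w _ IHu _ IHv t /=; rewrite [LHS]IHu [LHS]IHv.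
- move=> u u' v v' _ IHu _ IHv t /=.
  by rewrite !eval_word_mul; congr (_ * _); [apply: IHu | apply: IHv].
- by move=> s u v _ IH t /=; rewrite !eval_word_subst; apply: IH.
Qed.

Section DeductionQuotient.
Local Open Scope quotient_scope.
Variable B : set identity.

Definition deducibleb (u v : word) : bool := `[< deducible B u v >].

Lemma deducibleb_refl : reflexive deducibleb.
Proof. by move=> u; apply/asboolP; apply: ded_refl. Qed.

Lemma deducibleb_sym : symmetric deducibleb.
Proof. by move=> u v; apply/asboolP/asboolP; apply: ded_sym. Qed.

Lemma deducibleb_trans : transitive deducibleb.
Proof.
by move=> v u w /asboolP uv /asboolP vw; apply/asboolP; apply: ded_trans vw.
Qed.

Definition deducible_equiv : equiv_rel word :=
  EquivRel deducibleb deducibleb_refl deducibleb_sym deducibleb_trans.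

(** The relatively free semigroup of [models B] on countably many generators. *)
Definition word_quot : Type := {eq_quot deducible_equiv}.

HB.instance Definition _ := Choice.on word_quot.

Definition word_class (w : word) : word_quot := \pi_({eq_quot deducible_equiv}) w.

Definition word_quot_repr (q : word_quot) : word :=
  repr (q : {eq_quot deducible_equiv}).

Lemma word_quot_reprK : cancel word_quot_repr word_class.
Proof. by move=> q; apply: reprK. Qed.

Lemma word_classP (u v : word) : word_class u = word_class v <-> deducible B u v.
Proof.
split=> [uv|uv]; last by apply/eqmodP/asboolP.
by apply: asboolW; have /eqmodP := uv.
Qed.

Definition word_quot_mul (x y : word_quot) : word_quot :=
  word_class (word_quot_repr x * word_quot_repr y).

Lemma word_class_mul (u v : word) :
  word_quot_mul (word_class u) (word_class v) = word_class (u * v).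
Proof. by apply/word_classP; apply: ded_mul; apply/word_classP/word_quot_reprK. Qed.

Lemma word_quot_mulA : associative word_quot_mul.
Proof.
move=> x y z; rewrite -(word_quot_reprK x) -(word_quot_reprK y).
by rewrite -(word_quot_reprK z) !word_class_mul mulgA.
Qed.

HB.instance Definition _ := isSemigroup.Build word_quot word_quot_mulA.

Lemma eval_word_class (s : nat -> word) (w : word) :
  eval_word (word_class \o s) w = word_class (eval_word s w).
Proof.
have cM : {morph (word_class : word -> word_quot) : u v / u * v}.
  by move=> u v; rewrite -word_class_mul.
by rewrite [RHS](eval_over_morph (bundle_mul cM)).
Qed.

Lemma word_quot_satisfies (e : identity) : B e -> satisfies word_quot e.
Proof.
move=> eB t; have -> : t = word_class \o (word_quot_repr \o t).
  by apply/funext => x /=; rewrite word_quot_reprK.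
rewrite !eval_word_class; apply/word_classP/ded_subst/ded_axiom.
by case: e eB.
Qed.

End DeductionQuotient.

(** The quotient by deducibility is itself a model; sending each letter to its own class turns the
    identity into a deduction. *)
Lemma deducible_complete (B : set identity) (u v : word) :
  class_satisfies (models B) (u, v) -> deducible B u v.
Proof.
move=> Buv; have mQ : models B (word_quot B).
  by split; [exact: (inhabits (word_class B u)) | exact: word_quot_satisfies].
have /= := Buv _ mQ (@word_class B \o letter).
by rewrite !eval_word_class !eval_word_letter => /word_classP.
Qed.

(** * Identities of commutative semigroups with x^(n+p) = x^n *)

Definition letters (w : word) : seq nat := w.1 :: w.2.
Arguments letters w : simpl never.

(** Regrouping over a common list [L] makes the products of two words comparable factor by
    factor. *)
Lemma big_count_mem (R : Type) (idx : R) (op : Monoid.com_law idx) (I : eqType)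
    (l L : seq I) (F : I -> R) :
  uniq L -> {subset l <= L} ->
  \big[op/idx]_(x <- l) F x =
    \big[op/idx]_(x <- L) iterop (count_mem x l) op (F x) idx.
Proof.
move=> uL; elim: l => [|x l IHl] lL.
  by rewrite big_nil big1_seq.
rewrite big_cons IHl; last by move=> y yl; rewrite lL // inE yl orbT.
have xL : x \in L by rewrite lL ?mem_head.
rewrite !(bigD1_seq _ xL uL) /= Monoid.mulmA eqxx !Monoid.iteropE.
congr (op _ _); apply: eq_bigr => y /negPf yx.
by rewrite eq_sym yx add0n.
Qed.

Lemma prod_indicator (M : monoidType) (I : eqType) (l : seq I) (x : I) (a : M) :
  \prod_(y <- l) (if y == x then a else 1) = a ^+ count_mem x l.
Proof.
elim: l => [|y l IHl]; first by rewrite big_nil.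
by rewrite big_cons IHl /=; case: (y == x); rewrite ?mul1g ?add1n ?expgS.
Qed.

Lemma eval_word_monoid (M : monoidType) (t : nat -> M) (w : word) :
  eval_word t w = \prod_(x <- letters w) t x.
Proof.
case: w => x s; rewrite /eval_word /letters /=.
elim/last_ind: s => [|s y IHs]; first by rewrite big_seq1.
by rewrite foldl_rcons -rcons_cons IHs big_rcons.
Qed.

(** Iterated products and powers with exponent 0 need an identity element, so values in [S] are
    computed in S^1 and pulled back by injectivity. *)
Definition in_adjoin1 (S : semigroupType) (s : S) : adjoin1 S := Some s.

Lemma in_adjoin1_inj (S : semigroupType) : injective (@in_adjoin1 S).
Proof. by move=> x y []. Qed.

Lemma eval_word_adjoin1 (S : semigroupType) (t : nat -> S) (w : word) :
  in_adjoin1 (eval_word t w) = \prod_(x <- letters w) in_adjoin1 (t x).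
Proof.
rewrite -eval_word_monoid.
have sM : {morph (@in_adjoin1 S) : x y / x * y} by [].
exact: (eval_over_morph (bundle_mul sM)).
Qed.

Lemma prod_letter_pow (M : monoidType) (t : nat -> M) (x k : nat) : 0 < k ->
  \prod_(y <- letters (letter_pow x k)) t y = t x ^+ k.
Proof.
case: k => // k _; rewrite /letters /=.
elim: k => [|k IHk]; first by rewrite big_seq1.
by rewrite /= big_cons IHk [RHS]expgS.
Qed.

Definition commutative_power_basis (p n : nat) : set identity :=
  [set (letter_pow 0 (n + p), letter_pow 0 n);
       (letter 0 * letter 1, letter 1 * letter 0)].

(* The normal form of the exponent a modulo x^(n+p) = x^n. *)
Definition reduce_exponent (p n a : nat) : nat :=
  if a < n then a else n + (a - n) %% p.

Lemma reduce_exponent_lt (p n a : nat) : 0 < p -> reduce_exponent p n a < n + p.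
Proof.
move=> p0; rewrite /reduce_exponent; case: ifP => [an|_].
  exact: leq_trans an (leq_addr _ _).
by rewrite ltn_add2l ltn_mod.
Qed.

Lemma commutative_power_basisP (p n : nat) (S : semigroupType) : 0 < n ->
  (forall e, commutative_power_basis p n e -> satisfies S e) <->
  commutative (@mul S) /\
  forall s : S, in_adjoin1 s ^+ (n + p) = in_adjoin1 s ^+ n.
Proof.
move=> n0; have np0 : 0 < n + p by rewrite addn_gt0 n0.
split=> [SB|[mC powE] e].
  split=> [x y|s].
    by have /= := SB _ (or_intror erefl) (fun i => if i == 0 then x else y).
  have /(congr1 (@in_adjoin1 S)) := SB _ (or_introl erefl) (fun=> s).
  by rewrite !eval_word_adjoin1 !prod_letter_pow.
case=> -> t /=; last exact: mC.
apply: in_adjoin1_inj; rewrite !eval_word_adjoin1 !prod_letter_pow //.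
Qed.

Section CommutativePower.
Variables (p n : nat) (S : semigroupType).
Hypothesis n0 : 0 < n.
Hypothesis SB : forall e, commutative_power_basis p n e -> satisfies S e.

Lemma expg_reduce_exponent (s : S) (a : nat) :
  in_adjoin1 s ^+ a = in_adjoin1 s ^+ reduce_exponent p n a.
Proof.
have [_ powE] := (commutative_power_basisP p S n0).1 SB.
rewrite /reduce_exponent; case: ltnP => // na.
rewrite -{1}(subnKC na) {1}(divn_eq (a - n) p).
elim: (_ %/ p) => [|q IHq]; first by rewrite mul0n add0n.
by rewrite mulSn -addnA addnA expgnDr powE -expgnDr.
Qed.

Lemma adjoin1_mulC : commutative (@mul (adjoin1 S)).
Proof.
have [mC _] := (commutative_power_basisP p S n0).1 SB.
by case=> [a|] [b|] //; congr Some; apply: mC.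
Qed.

Definition adjoin1_com_law : Monoid.com_law (1 : adjoin1 S) :=
  HB.pack (@mul (adjoin1 S))
    (Monoid.isComLaw.Build (adjoin1 S) 1 (@mul (adjoin1 S))
       (@mulgA (adjoin1 S)) adjoin1_mulC (@mul1g (adjoin1 S))).

Lemma prod_in_adjoin1 (t : nat -> S) (l L : seq nat) :
  uniq L -> {subset l <= L} ->
  \prod_(x <- l) in_adjoin1 (t x) =
    \prod_(x <- L) in_adjoin1 (t x) ^+ count_mem x l.
Proof.
move=> uL lL.
exact: (big_count_mem adjoin1_com_law (fun x => in_adjoin1 (t x)) uL lL).
Qed.

(** Over a list of all letters of both words, the two values are products of powers whose exponents
    matter only after reduction. *)
Lemma satisfies_of_reduced_counts (u v : word) :
  (forall x, reduce_exponent p n (count_mem x (letters u)) =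
             reduce_exponent p n (count_mem x (letters v))) ->
  satisfies S (u, v).
Proof.
move=> uv t; apply: in_adjoin1_inj.
rewrite (eval_word_adjoin1 t u) (eval_word_adjoin1 t v).
pose L := undup (letters u ++ letters v).
have uL : uniq L by rewrite undup_uniq.
have lu : {subset letters u <= L} by move=> x xu; rewrite mem_undup mem_cat xu.
have lv : {subset letters v <= L}.
  by move=> x xv; rewrite mem_undup mem_cat xv orbT.
rewrite (prod_in_adjoin1 t uL lu) (prod_in_adjoin1 t uL lv).
by apply: eq_bigr => x _; rewrite expg_reduce_exponent uv -expg_reduce_exponent.
Qed.

End CommutativePower.

(** * The variety generated by Z_p and N_n^1 *)

Lemma var2_satisfies (A B : semigroupType) (e : identity) :
  inhabited A -> inhabited B ->
  class_satisfies (var2 A B) e <-> satisfies A e /\ satisfies B e.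
Proof.
move=> Ai Bi; split=> [h|[Ae Be] S VS].
  by split; apply: h => V.
(* The models of the single identity [e] form a variety containing both generators. *)
have mS : models [set e] S.
  by apply: VS; [exact: models_variety | split=> // _ ->..].
by apply: mS.2.
Qed.

Lemma var2_variety (A B : semigroupType) :
  inhabited A -> inhabited B -> variety (var2 A B).
Proof.
move=> Ai Bi; split.
- by move=> S VS; have [] : models set0 S by apply: VS => //; exact: models_variety.
- move=> S T f fs VS V hV hA hB; have [_ im _ _] := hV.
  by apply: im fs _; apply: VS.
- move=> S T f Si fi VT V hV hA hB; have [_ _ sub _] := hV.
  by apply: sub Si fi _; apply: VT.
- move=> I T VT V hV hA hB; have [_ _ _ pr] := hV.
  by apply: pr => i; apply: VT.
Qed.

(** Index [i] stands for a^(i+1), whence the shifts by one; the minimum with [n.-1] is absorption by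
    zero. *)
Lemma nil_monoid_expg (n : nat) (i : nil_sg n) (k : nat) :
  omap (@nat_of_ord n) (in_adjoin1 i ^+ k.+1) = Some (minn (i.+1 * k.+1).-1 n.-1).
Proof.
elim: k => [|k IHk].
  rewrite expg1 /= muln1 /=; congr Some; apply/esym/minn_idPl.
  by case: (n) i => [|m] i; [case: i | rewrite -ltnS].
rewrite expgS; case: (_ ^+ k.+1) IHk => [j|] //= [jE].
by rewrite jE; congr Some; lia.
Qed.

Lemma cyclic_expg (p : nat) (i : 'I_p.-1.+1) (k : nat) : 0 < p ->
  (i ^+ k : 'I_p.-1.+1) = (i * k) %% p :> nat.
Proof.
case: p i => // q i _; elim: k => [|k IHk]; first by rewrite muln0 mod0n.
by rewrite expgS mulnS /= IHk modnDmr.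
Qed.

Lemma expg_in_adjoin1 (M : monoidType) (s : M) (k : nat) : 0 < k ->
  in_adjoin1 s ^+ k = in_adjoin1 (s ^+ k).
Proof.
case: k => // k _; elim: k => [|k IHk] //.
by rewrite [LHS]expgS IHk [in RHS]expgS.
Qed.

Section Generators.
Variables (p n : nat).
Hypotheses (p0 : 0 < p) (n0 : 0 < n).

Lemma cyclic_semigroup_basis (e : identity) :
  commutative_power_basis p n e -> satisfies (cyclic_semigroup p) e.
Proof.
move: e; apply/commutative_power_basisP => //; split=> [x y|s].
  by apply: val_inj; rewrite /= addnC.
rewrite !(@expg_in_adjoin1 'I_p.-1.+1) ?addn_gt0 ?n0 //; congr in_adjoin1.
by apply: val_inj; rewrite /= !cyclic_expg // mulnDr addnC modnMDl.
Qed.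

Lemma nil_monoid_basis (e : identity) :
  commutative_power_basis p n e -> satisfies (nil_monoid n) e.
Proof.
have nilC (i j : nil_sg n) : i * j = j * i.
  by apply: val_inj; rewrite /= addnC.
move: e; apply/commutative_power_basisP => //; split.
  by case=> [i|] [j|] //; congr Some.
move=> s; rewrite !(@expg_in_adjoin1 (adjoin1 (nil_sg n))) ?addn_gt0 ?n0 //.
congr in_adjoin1; case: s => [i|]; last by rewrite !expg1n.
apply: (inj_omap (@ord_inj n)); rewrite -!/(in_adjoin1 i).
case: n n0 i => // m _ i; rewrite addSn !nil_monoid_expg; congr Some.
by nia.
Qed.

(** Sending [x] to the residue of 1 and all other letters to the neutral element evaluates a word to
    its number of [x] modulo [p]. *)
Lemma cyclic_semigroup_satisfies (u v : word) (x : nat) :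
  satisfies (cyclic_semigroup p) (u, v) ->
  count_mem x (letters u) = count_mem x (letters v) %[mod p].
Proof.
move=> uv; pose a : 'I_p.-1.+1 := inZp 1.
have /(congr1 val) := uv (fun y => if y == x then a else 1).
rewrite /= !(@eval_word_monoid 'I_p.-1.+1) !prod_indicator /=.
by rewrite !cyclic_expg //= prednK // !modnMml !mul1n.
Qed.

(** Sending [x] to [a] and all other letters to the adjoined identity evaluates a word to a power of
    [a], whose exponent is visible up to [n]. *)
Lemma nil_monoid_satisfies (u v : word) (x : nat) :
  satisfies (nil_monoid n) (u, v) ->
  minn n (count_mem x (letters u)) = minn n (count_mem x (letters v)).
Proof.
move=> uv; have [m nE] : exists m, n = m.+1 by exists n.-1; rewrite prednK.
pose a : nil_sg n := cast_ord (esym nE) ord0.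
have aE : a = 0 :> nat by [].
have : in_adjoin1 a ^+ count_mem x (letters u) =
       in_adjoin1 a ^+ count_mem x (letters v).
  have /= := uv (fun y => if y == x then in_adjoin1 a else 1).
  by rewrite !(@eval_word_monoid (adjoin1 (nil_sg n))) !prod_indicator.
move: (count_mem x (letters u)) (count_mem x (letters v)) => [|k] [|l] //.
(* If [x] occurs in only one word, one value is the adjoined identity and the other is not. *)
- by move=> /(congr1 (omap (@nat_of_ord n))); rewrite nil_monoid_expg.
- by move=> /(congr1 (omap (@nat_of_ord n))); rewrite nil_monoid_expg.
move=> /(congr1 (omap (@nat_of_ord n))); rewrite !nil_monoid_expg aE !mul1n => -[].
by rewrite nE; lia.
Qed.

Lemma reduce_exponent_eq (a b : nat) :
  a = b %[mod p] -> minn n a = minn n b ->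
  reduce_exponent p n a = reduce_exponent p n b.
Proof.
rewrite /reduce_exponent => abp abn; case: (ltnP a n) => an; case: (ltnP b n) => bn; try lia.
congr addn; apply/eqP; rewrite -(eqn_modDr n) !subnK //; exact/eqP.
Qed.

Lemma class_satisfies_var2 (u v : word) :
  class_satisfies (var2 (cyclic_semigroup p) (nil_monoid n)) (u, v) ->
  deducible (commutative_power_basis p n) u v.
Proof.
move=> uv; apply: deducible_complete => S [_ SB].
have Ai : inhabited (cyclic_semigroup p) := inhabits (1 : 'I_p.-1.+1).
have Bi : inhabited (nil_monoid n) := inhabits (None : adjoin1 _).
have [ua ub] := (var2_satisfies (u, v) Ai Bi).1 uv.
apply: (satisfies_of_reduced_counts n0 SB) => x; apply: reduce_exponent_eq.
  exact: cyclic_semigroup_satisfies.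
exact: nil_monoid_satisfies.
Qed.

(** One inclusion is minimality of the generated variety; the other is Birkhoff's theorem, as every
    identity of that variety is deducible from the basis. *)
Lemma var2_models (S : semigroupType) :
  var2 (cyclic_semigroup p) (nil_monoid n) S <->
  models (commutative_power_basis p n) S.
Proof.
have Ai : inhabited (cyclic_semigroup p) := inhabits (1 : 'I_p.-1.+1).
have Bi : inhabited (nil_monoid n) := inhabits (None : adjoin1 _).
split=> [|[Si SB]].
  apply; first exact: models_variety.
    by split=> // e; apply: cyclic_semigroup_basis.
  by split=> // e; apply: nil_monoid_basis.
apply: birkhoff => //; first exact: var2_variety.
move=> [u v] /class_satisfies_var2; exact: deducible_sound.
Qed.

Lemma var2_identity_basis :
  identity_basis (var2 (cyclic_semigroup p) (nil_monoid n))
    (commutative_power_basis p n).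
Proof.
split=> [e eB S /var2_models[_]|]; first exact.
exact: class_satisfies_var2.
Qed.

End Generators.

(** * Dickson's lemma and finite bases *)

(** Each index is chosen to minimise [f] on the tail after the previous one. *)
Lemma nondecreasing_subsequence (f : nat -> nat) :
  exists s : nat -> nat, {homo s : i j / i < j} /\ {homo f \o s : i j / i <= j}.
Proof.
have min m : exists i, m <= i /\ forall j, m <= j -> f i <= f j.
  have ex : exists v, `[< exists i, m <= i /\ f i = v >].
    by exists (f m); apply/asboolP; exists m.
  case: (ex_minnP ex) => v /asboolP[i [mi <-]] vmin.
  by exists i; split=> // j mj; apply: vmin; apply/asboolP; exists j.
have [g Hg] := choice min.
pose s := fix s k := if k is k'.+1 then g (s k').+1 else g 0.
have slt : {homo s : i j / i < j}.
  by apply: homo_ltn => [|i]; [exact: ltn_trans | case: (Hg (s i).+1)].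
exists s; split=> // i j; rewrite leq_eqVlt => /predU1P[-> //|/slt/ltnW sij] /=.
by case: i sij => [|i] sij; apply: (Hg _).2 => //; apply: leq_trans sij; case: (Hg (s i).+1).
Qed.

(** Subsequences are extracted for one coordinate after another; refining keeps the earlier
    coordinates monotone. *)
Lemma dickson (T : Type) (I : eqType) (F : I -> T -> nat) (l : seq I)
    (a : nat -> T) :
  exists s : nat -> nat, {homo s : i j / i < j} /\
    forall c, c \in l -> {homo F c \o a \o s : i j / i <= j}.
Proof.
elim: l => [|c l [s [slt sl]]]; first by exists id; split.
have [r [rlt rc]] := nondecreasing_subsequence (F c \o a \o s).
exists (s \o r); split=> [i j ij|d]; first exact/slt/rlt.
rewrite inE => /predU1P[-> //|dl] i j ij; apply: sl => //.
exact: (ltnW_homo rlt).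
Qed.

(** If no finite list worked, one could keep choosing members of [P] above no earlier choice,
    against the hypothesis on sequences. *)
Lemma finite_minimal_elements (T : eqType) (R : T -> T -> Prop) (P : T -> Prop) :
  (forall a : nat -> T, exists i j, i < j /\ R (a i) (a j)) ->
  exists l : seq T, {in l, forall x, P x} /\
    forall y, P y -> exists2 x, x \in l & R x y.
Proof.
move=> wqo; apply: contrapT => /forallNP nol.
have next (l : seq T) : exists y, {in l, forall x, P x} ->
    P y /\ {in l, forall x, ~ R x y}.
  have [lP|] := pselect {in l, forall x, P x}; last first.
    (* A list not contained in [P] is nonempty and so supplies a default element. *)
    move=> lP; have [z zl] : exists z, z \in l.
      apply: contrapT => /forallNP lz; apply: lP => x xl; by case: (lz x).
    by exists z => /lP.
  have /not_andP[//|/existsNP[y /not_implyP[Py yl]]] := nol l.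
  by exists y => _; split=> // x xl Rxy; apply: yl; exists x.
have [g Hg] := choice next.
pose s := fix s k := if k is k'.+1 then g (s k') :: s k' else [::].
have sP k : {in s k, forall x, P x}.
  elim: k => [|k IHk] x //=.
  by rewrite inE => /predU1P[->|/IHk //]; case: (Hg (s k) IHk).
have sg i j : i < j -> g (s i) \in s j.
  elim: j => // j IHj; rewrite ltnS leq_eqVlt => /predU1P[->|/IHj ij] /=.
    exact: mem_head.
  by rewrite inE ij orbT.
have [i [j [ij Rij]]] := wqo (g \o s).
by case: (Hg (s j) (sP j)) => _ /(_ _ (sg _ _ ij)).
Qed.

(** Each element is represented by its least code under [g]; the set [A] of least codes is infinite
    because of [h], hence in bijection with [nat]. *)
Lemma countably_infinite_range (X : Type) (P : X -> Prop) (g h : nat -> X) :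
  (forall x, P x <-> exists k, g k = x) -> injective h -> (forall j, P (h j)) ->
  countably_infinite P.
Proof.
move=> Pg hinj Ph.
pose A : set nat := [set k | forall i, g i = g k -> k <= i].
have Arep x : P x -> exists k, A k /\ g k = x.
  move=> /Pg[k0 gk0]; have ex : exists k, `[< g k = x >].
    by exists k0; apply/asboolP.
  case: (ex_minnP ex) => k /asboolP gk kmin; exists k; split=> // i.
  by rewrite gk => gi; apply: kmin; apply/asboolP.
have Ainj i j : A i -> A j -> g i = g j -> i = j.
  by move=> Ai Aj gij; apply/eqP; rewrite eqn_leq Ai ?Aj.
have [r Hr] := choice (fun j => Arep _ (Ph j)).
have Ainf : infinite_set A.
  have rinj : {in [set: nat] &, injective r}.
    by move=> i j _ _ rij; apply: hinj; rewrite -(Hr i).2 -(Hr j).2 rij.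
  have rA : set_fun [set: nat] A r by move=> j _; case: (Hr j).
  have [r' rE] := Pinj rinj; rewrite rE in rA.
  by have [i _] := injPfun rA; apply/infiniteP/(inj_card_le i).
have /card_esym/card_set_bijP[f [fA finj fsurj]] :=
  eq_card_nat (countableP A) Ainf.
exists (g \o f); split=> [i j /= gij|x].
  by apply: finj; rewrite ?in_setT //; apply: Ainj gij; apply: fA.
split=> [/Arep[k [Ak <-]]|[k <-]]; last by apply/Pg; exists (f k).
by have [j _ <-] := fsurj k Ak; exists j.
Qed.

Section FiniteBasis.
Variables (p n : nat).
Hypotheses (p0 : 0 < p) (n0 : 0 < n).

Definition identity_letters (e : identity) : seq nat :=
  undup (letters e.1 ++ letters e.2).

(* The pair of reduced multiplicities of x on the two sides of e. *)
Definition letter_type (e : identity) (x : nat) : nat * nat :=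
  (reduce_exponent p n (count_mem x (letters e.1)),
   reduce_exponent p n (count_mem x (letters e.2))).

Definition type_count (c : nat * nat) (e : identity) : nat :=
  count (fun x => letter_type e x == c) (identity_letters e).

(** Together the two clauses force equal supports, so that the letters of [f] can be mapped onto
    those of [e] with types preserved. *)
Definition type_le (e f : identity) : Prop :=
  forall c, type_count c e <= type_count c f /\
    (type_count c e = 0 -> type_count c f = 0).

Lemma type_count_out (c : nat * nat) (e : identity) :
  ~~ ((c.1 < n + p) && (c.2 < n + p)) -> type_count c e = 0.
Proof.
move=> cN; apply/eqP; rewrite /type_count -leqn0 leqNgt -has_count.
apply/hasPn => x _; apply: contra cN => /eqP <-.
by rewrite /= !reduce_exponent_lt.
Qed.

Lemma type_le_wqo (a : nat -> identity) :
  exists i j, i < j /\ type_le (a i) (a j).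
Proof.
(* Besides each count, its vanishing is a coordinate with values 0 and 1; monotonicity of that
   coordinate is the second clause of [type_le]. *)
pose F (c : bool * (nat * nat)) e :=
  if c.1 then type_count c.2 e else nat_of_bool (type_count c.2 e == 0).
pose N := iota 0 (n + p).
pose l := allpairs pair [:: true; false] (allpairs pair N N).
have [s [slt sF]] := dickson F l a.
exists (s 0), (s 1%N); split=> [|c]; first exact: slt.
have [cN|/type_count_out cN] := boolP ((c.1 < n + p) && (c.2 < n + p)); last first.
  by rewrite !cN.
have cl b : (b, c) \in l.
  case: c cN => i j /andP[iN jN].
  by apply: allpairs_f; [case: b | apply: allpairs_f; rewrite mem_iota].
have := sF _ (cl true) 0 1%N isT; have := sF _ (cl false) 0 1%N isT.
by rewrite /F /=; case: eqP => //; case: eqP => //; lia.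
Qed.

Lemma letters_eval_word (s : nat -> word) (w : word) :
  letters (eval_word s w) = flatten [seq letters (s x) | x <- letters w].
Proof.
case: w => x r.
rewrite -[RHS]/(letters (s x) ++ flatten [seq letters (s y) | y <- r]).
rewrite /eval_word; elim/last_ind: r => [|r y IHr]; first by rewrite cats0.
by rewrite foldl_rcons map_rcons flatten_rcons catA -IHr.
Qed.

(* Each letter of f is matched with a letter of e of the same type, every letter
   of e being hit; substituting for each letter of e the product of the letters
   matched with it turns e into f, up to reduction of exponents. *)
Lemma satisfies_type_le (S : semigroupType) (e f : identity) :
  (forall e, commutative_power_basis p n e -> satisfies S e) ->
  type_le e f -> satisfies S e -> satisfies S f.
Proof.
move=> SB ef Se.
pose fib (g : identity) c := [seq x <- identity_letters g | letter_type g x == c].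
have sz g c : size (fib g c) = type_count c g by rewrite size_filter.
have ufib g c : uniq (fib g c) by rewrite filter_uniq ?undup_uniq.
(* Within each type, the i-th letter of [f] goes to the i-th letter of [e], and surplus letters go
   to the first one. *)
pose phi x := let l := fib e (letter_type f x) in
  nth (head 0 l) l (index x (fib f (letter_type f x))).
have phiP x : x \in identity_letters f ->
    phi x \in identity_letters e /\ letter_type e (phi x) = letter_type f x.
  move=> xf; have : phi x \in fib e (letter_type f x).
    have : 0 < size (fib e (letter_type f x)).
      rewrite sz lt0n; apply/eqP => /(ef _).2; apply/eqP.
      by rewrite -lt0n -has_count; apply/hasP; exists x.
    rewrite /phi; case: (fib e _) => // y l _ /=.
    have [il|il] := ltnP (index x (fib f (letter_type f x))) (size l).+1.
      by rewrite mem_nth.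
    by rewrite nth_default ?mem_head.
  by rewrite mem_filter => /andP[/eqP].
have phi_surj y : y \in identity_letters e ->
    exists2 x, x \in identity_letters f & phi x = y.
  move=> ye; pose c := letter_type e y.
  have yc : y \in fib e c by rewrite mem_filter eqxx.
  have ltf : index y (fib e c) < size (fib f c).
    by rewrite sz (leq_trans _ (ef c).1) // -sz index_mem.
  have := mem_nth 0 ltf; set x := nth 0 _ _ => xc.
  have := xc; rewrite mem_filter => /andP[/eqP xE xf]; exists x => //.
  by rewrite /phi xE index_uniq // nth_index.
pose pre y := [seq x <- identity_letters f | phi x == y].
(* For letters of [e] the fibre is nonempty, so the default 0 is not reached there. *)
pose s y : word := (head 0 (pre y), behead (pre y)).
have sE y : y \in identity_letters e -> letters (s y) = pre y.
  move=> /phi_surj[x xf xy].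
  have : x \in pre y by rewrite mem_filter xy eqxx.
  by rewrite /s /letters; case: (pre y).
(* The fibres of [phi] are disjoint: [x] comes only from the letter [phi x], once per occurrence. *)
have cnt u x : {subset letters u <= identity_letters e} ->
    count_mem x (letters (eval_word s u)) =
    if x \in identity_letters f then count_mem (phi x) (letters u) else 0.
  rewrite letters_eval_word; elim: (letters u) => [|y l IHl] lE; first by case: ifP.
  rewrite -[flatten _]/(letters (s y) ++ flatten [seq letters (s z) | z <- l]).
  rewrite count_cat IHl; last by move=> z zl; rewrite lE // inE zl orbT.
  rewrite sE ?lE ?mem_head // count_uniq_mem ?filter_uniq ?undup_uniq //=.
  by rewrite mem_filter eq_sym; case: (x \in _); rewrite ?andbT ?andbF.
have e1 : {subset letters e.1 <= identity_letters e}.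
  by move=> x xe; rewrite mem_undup mem_cat xe.
have e2 : {subset letters e.2 <= identity_letters e}.
  by move=> x xe; rewrite mem_undup mem_cat xe orbT.
have notin x : x \notin identity_letters f ->
    count_mem x (letters f.1) = 0 /\ count_mem x (letters f.2) = 0.
  by rewrite mem_undup mem_cat negb_or => /andP[/count_memPn-> /count_memPn->].
have S1 : satisfies S (f.1, eval_word s e.1).
  apply: (satisfies_of_reduced_counts n0 SB) => x; rewrite cnt //.
  by case: ifP => [/phiP[_ []]|/negbT/notin[-> _]].
have S2 : satisfies S (f.2, eval_word s e.2).
  apply: (satisfies_of_reduced_counts n0 SB) => x; rewrite cnt //.
  by case: ifP => [/phiP[_ []]|/negbT/notin[_ ->]].
move=> t; have /= -> := S1 t; have /= -> := S2 t.
by rewrite !eval_word_subst; apply: Se.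
Qed.

Definition models_seq (l : seq identity) : sgclass :=
  models (commutative_power_basis p n `|` [set e | e \in (l : seq (word * word))]).

Lemma models_seqP (l : seq identity) (S : semigroupType) :
  models_seq l S <->
  models (commutative_power_basis p n) S /\
  forall e, e \in (l : seq (word * word)) -> satisfies S e.
Proof.
split=> [[Si SB]|[[Si SB] Sl]].
  by split=> [|e el]; [split=> // e eB; apply: SB; left | apply: SB; right].
by split=> // e [/SB|/Sl].
Qed.

(** Finitely many identities of [W] lie below all its identities for [type_le], hence imply them;
    Birkhoff's theorem concludes. *)
Lemma subvariety_finitely_based (W : sgclass) :
  variety W -> (forall S, W S -> models (commutative_power_basis p n) S) ->
  exists l, W = models_seq l.
Proof.
move=> Wvar WB.
have [l [lW Wl]] := @finite_minimal_elements (word * word)%type type_le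
  (class_satisfies W) type_le_wqo.
exists l; apply/funext => S; apply/propext; rewrite models_seqP.
split=> [WS|[[Si SB] Sl]].
  by split=> [|e /lW]; [exact: WB | apply].
apply: birkhoff => // f /Wl[e el ef].
exact: satisfies_type_le SB ef (Sl e el).
Qed.

End FiniteBasis.

(** * Infinitely many subvarieties *)

(* The empty set is kept only to avoid a subtype: all its products are None. *)
Definition union_sg (k : nat) : Type := option {set 'I_k}.

Section UnionSg.
Variable k : nat.

HB.instance Definition _ := Choice.copy (union_sg k) (option {set 'I_k}).

Definition union_sg_mul (x y : union_sg k) : union_sg k :=
  if (x, y) is (Some A, Some B) then
    if [&& A != finset.set0, B != finset.set0 & A :&: B == finset.set0]
    then Some (A :|: B) else None
  else None.

(** Both sides are the union if the three sets are nonempty and pairwise disjoint, and [None]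
    otherwise. *)
Lemma union_sg_mulA : associative union_sg_mul.
Proof.
have setU_neq0 (A B : {set 'I_k}) :
    (A :|: B != finset.set0) = (A != finset.set0) || (B != finset.set0).
  by rewrite finset.setU_eq0 negb_and.
case=> [A|] [B|] [C|] //=; rewrite /union_sg_mul //=; last by case: ifP.
have dU : ((A :|: B) :&: C == finset.set0) =
    (A :&: C == finset.set0) && (B :&: C == finset.set0).
  by rewrite finset.setIUl finset.setU_eq0.
have dUr : (A :&: (B :|: C) == finset.set0) =
    (A :&: B == finset.set0) && (A :&: C == finset.set0).
  by rewrite finset.setIUr finset.setU_eq0.
have [A0|A0] := boolP (A == finset.set0); have [B0|B0] := boolP (B == finset.set0);
  have [C0|C0] := boolP (C == finset.set0);
  case disAB: (A :&: B == finset.set0);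
  case disBC: (B :&: C == finset.set0);
  case disAC: (A :&: C == finset.set0);
  by do 3!rewrite ?setU_neq0 ?dU ?dUr ?A0 ?B0 ?C0 ?disAB ?disBC ?disAC /=;
    rewrite ?finset.setUA.
Qed.

HB.instance Definition _ := isSemigroup.Build (union_sg k) union_sg_mulA.

Lemma union_sg_mulC : commutative (@mul (union_sg k)).
Proof.
case=> [A|] [B|] //; rewrite /mul /= /union_sg_mul /=.
by rewrite finset.setUC finset.setIC andbCA.
Qed.

Lemma union_sg_sq (x : union_sg k) : x * x = None.
Proof.
case: x => [A|] //; rewrite /mul /= /union_sg_mul finset.setIid.
by case: eqP.
Qed.

Lemma union_sg_expg (x : union_sg k) (m : nat) : 1 < m ->
  in_adjoin1 x ^+ m = in_adjoin1 (None : union_sg k).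
Proof.
case: m => [|[|m]] // _; elim: m => [|m IHm].
  by rewrite expg2 -(union_sg_sq x).
by rewrite expgS IHm; case: x {IHm}.
Qed.

(** The factors are disjoint and each contributes a point; a one-letter word is excluded, since its
    value may be the empty set. *)
Lemma union_sg_card (t : nat -> union_sg k) (w : word) (A : {set 'I_k}) :
  w.2 <> [::] -> eval_word t w = Some A -> size w.2 < #|A|.
Proof.
case: w => x s; rewrite /eval_word /=.
elim/last_ind: s A => [|s y IHs] A // _; rewrite foldl_rcons.
case: (foldl _ _ s) IHs => [B|] // IHs; case: (t y) => [C|] //.
rewrite /mul /= /union_sg_mul; case: ifP => // /and3P[B0 C0 disBC] [<-].
rewrite size_rcons cardsU (eqP disBC) cards0 subn0.
have C1 : 0 < #|C| by rewrite card_gt0.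
have sB : size s < #|B|.
  by case: s IHs => [|z s] IHs; [rewrite card_gt0 | apply: IHs].
by lia.
Qed.

End UnionSg.

(* x_0 x_1 ... x_j = x_(j+1)^2 *)
Definition nilpotency_identity (j : nat) : identity :=
  ((0, iota 1 j), (j.+1, [:: j.+1])).

Lemma union_sg_basis (p n k : nat) (e : identity) : 1 < n ->
  commutative_power_basis p n e -> satisfies (union_sg k) e.
Proof.
move=> n1; move: e; apply/commutative_power_basisP; first exact: ltnW.
split=> [|s]; first exact: union_sg_mulC.
by rewrite !union_sg_expg // (leq_trans n1) ?leq_addr.
Qed.

(** A [k]-element set has no [k.+1] disjoint nonempty subsets, so both sides are [None]. *)
Lemma union_sg_nilpotency (k : nat) : 0 < k ->
  satisfies (union_sg k) (nilpotency_identity k).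
Proof.
move=> k0 t; rewrite [RHS]union_sg_sq.
case E: (eval_word t _) => [A|] //.
have /union_sg_card/(_ E) : (nilpotency_identity k).1.2 <> [::].
  by rewrite /=; case: (k) k0.
rewrite size_iota => kA; have := max_card A.
by rewrite card_ord leqNgt kA.
Qed.

Lemma union_sg_not_nilpotency (j k : nat) : j < k ->
  ~ satisfies (union_sg k) (nilpotency_identity j).
Proof.
(* The letters up to [j] become distinct singletons, whose product is a set, whereas every square is
   [None]. *)
move=> jk; pose t i : union_sg k := Some [set x : 'I_k | (x == i :> nat)]%SET.
have tE m : m <= j ->
    eval_word t (0, iota 1 m) = Some [set x : 'I_k | x <= m]%SET.
  elim: m => [|m IHm] mj.
    congr Some; apply/setP => x.
    by rewrite !finset.inE leqn0.
  rewrite -(addn1 m) iotaD /eval_word /= foldl_cat /= add1n.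
  have := IHm (ltnW mj); rewrite /eval_word /= => ->.
  rewrite /mul /= /union_sg_mul ifT.
    by congr Some; apply/setP => x; rewrite !finset.inE; lia.
  have k0 : 0 < k by lia.
  have mk : m.+1 < k by lia.
  apply/and3P; split.
  - by apply/set0Pn; exists (Ordinal k0); rewrite finset.inE.
  - by apply/set0Pn; exists (Ordinal mk); rewrite finset.inE /=.
  - apply/eqP/setP => x; rewrite !finset.inE; lia.
by move=> /(_ t); rewrite [RHS]union_sg_sq /= tE.
Qed.

Theorem propositionC1 (p n : nat) (hp : (1 <= p)%N) (hn : (2 <= n)%N) :
  identity_basis (var2 (cyclic_semigroup p) (nil_monoid n))
    [set (letter_pow 0 (n + p), letter_pow 0 n);
         (letter 0 * letter 1, letter 1 * letter 0)] /\
  countably_infinite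
    (subvariety (var2 (cyclic_semigroup p) (nil_monoid n))).
Proof.
have n0 : 0 < n := ltnW hn.
split; first exact: var2_identity_basis.
have VP := var2_models hp n0.
pose M := models_seq p n.
have Msub l : subvariety (var2 (cyclic_semigroup p) (nil_monoid n)) (M l).
  split=> [|S /models_seqP[SB _]]; first exact: models_variety.
  exact/VP.
pose code : Type := seq ((nat * seq nat) * (nat * seq nat)).
(* Finite lists of identities are countable; numbers coding no list fall back to the empty list,
   which gives the whole variety. *)
pose g k : sgclass := M (odflt [::] (unpickle k : option code)).
pose h j : sgclass := M [:: nilpotency_identity j.+1].
apply: (@countably_infinite_range _ _ g h) => [W|i j|j]; last exact: Msub.
  split=> [[Wvar WV]|[k <-]]; last exact: Msub.
  have [|l ->] := subvariety_finitely_based hp n0 Wvar.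
    by move=> S /WV/VP.
  by exists (pickle (l : code)); rewrite /g pickleK.
(* With [hUa], the index [a] is recovered from [h a] as the largest [b] such that [union_sg b.+1] is
   a member. *)
have hU a b : h a (union_sg b.+1) -> b <= a.
  move=> /models_seqP[_ /(_ _ (mem_head _ _))]; apply: contraPT.
  by rewrite -ltnNge => ab; apply: union_sg_not_nilpotency.
have hUa a : h a (union_sg a.+1).
  apply/models_seqP; split; first split.
  - by split; exact: (None : union_sg a.+1).
  - by move=> e; apply: union_sg_basis.
  - move=> e; rewrite mem_seq1 => /eqP ->; exact: union_sg_nilpotency.
move=> hij; apply/eqP; rewrite eqn_leq.
by rewrite (hU j i) -?hij // (hU i j) // hij.
Qed.
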